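(* Let $k$ be a natural number and let $\mathcal{B}$ be a set of $k$-ary $\mathbb{VPC}$ parametric definitions such that (1) $\mathcal{B}$ is nonempty; (2) some $k$-ary parametric definition is not in $\mathcal{B}$; (3) $\mathcal{B}$ is closed under absolute equality (if $D\in\mathcal{B}$ and $D'$ equals $D$ then $D'\in\mathcal{B}$). Then the set $\{j \mid \mathcal{U}^{[i,\jmath][k]}_{j}(x_1,\dots,x_k)\in\mathcal{B}\ \text{for some type } [i,\jmath]\}$ is undecidable.
   Context: $\mathbb{VPC}$ is the value-passing calculus over Presburger arithmetic: terms $T ::= \mathbf{0}\mid a(x).T\mid \overline{a}(t).T\mid T|T\mid (c)T\mid \mathit{if}\ \varphi\ \mathit{then}\ T\mid D(t_1,\dots,t_k)$, with value terms $t$ built from numbers, number variables and $+$, Presburger formulas $\varphi$, names $a,c$, and parametric (possibly recursive) definitions $D(x_1,\dots,x_k)=T$; standard labelled transition semantics with actions $a(i),\overline{a}(i),\tau$. $=_{\mathbb{VPC}}$ is the absolute equality: the largest reflexive relation on processes that is closed under $(c)\_$ and parallel composition, equipollent (preserves the ability to eventually perform a non-$\tau$ action), codivergent and a branching-style bisimulation for $\tau$-steps. Two $k$-ary parametric definitions are equal if all their instances at tuples of numbers are $=_{\mathbb{VPC}}$. A $k$-ary definition $D(z_1,\dots,z_k)=T$ is of type $[i,\jmath]$ if $T$ has $i$ local names and $\jmath$ is the list of its global names. For each type $[i,\jmath]$ the $k$-ary definitions of that type are effectively Gödel-numbered, and $\mathcal{U}^{[i,\jmath][k]}_{z}(z_1,\dots,z_k)$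 is a universal parametric definition: for each index $j$ of a definition $D$ of type $[i,\jmath]$, $\mathcal{U}^{[i,\jmath][k]}_{j}(z_1,\dots,z_k)$ equals $D(z_1,\dots,z_k)$.
   Formalization: The Gödel numbering is one fixed numbering common to all types, and U_j is considered only at a type for which j is an index; with separate total numberings for each type the set can be all numbers, e.g. for B = definitions not equal to ā(0).0. *)

(* Defs.v *)
From Stdlib Require Import Relations.
From mathcomp Require Import all_boot.

Set Implicit Arguments.
Unset Strict Implicit.
Unset Printing Implicit Defensive.

Notation name := nat (only parsing).
Notation var := nat (only parsing).

Inductive vterm :=
| Num of nat
| Var of var
| Plus of vterm & vterm.

Inductive formula :=
| FEq of vterm & vterm
| FLt of vterm & vterm
| FNot of formula
| FAnd of formula & formula
| FOr of formula & formula
| FImp of formula & formula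
| FAll of var & formula
| FEx of var & formula.

Definition update (rho : var -> nat) (x : var) (n : nat) : var -> nat :=
  fun y => if y == x then n else rho y.

Fixpoint veval (rho : var -> nat) (t : vterm) : nat :=
  match t with
  | Num n => n
  | Var x => rho x
  | Plus t1 t2 => veval rho t1 + veval rho t2
  end.

Fixpoint holds (rho : var -> nat) (phi : formula) : Prop :=
  match phi with
  | FEq t1 t2 => veval rho t1 = veval rho t2
  | FLt t1 t2 => veval rho t1 < veval rho t2
  | FNot p => ~ holds rho p
  | FAnd p q => holds rho p /\ holds rho q
  | FOr p q => holds rho p \/ holds rho q
  | FImp p q => holds rho p -> holds rho q
  | FAll x p => forall n, holds (update rho x n) p
  | FEx x p => exists n, holds (update rho x n) p
  end.

(* In a process every value term and formula that is evaluated is closed, so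
   the valuation below plays no role there. *)
Definition value (t : vterm) : nat := veval (fun=> 0) t.
Definition valid (phi : formula) : Prop := holds (fun=> 0) phi.

Fixpoint vclosed (V : seq var) (t : vterm) : bool :=
  match t with
  | Num _ => true
  | Var x => x \in V
  | Plus t1 t2 => vclosed V t1 && vclosed V t2
  end.

Fixpoint fclosed (V : seq var) (phi : formula) : bool :=
  match phi with
  | FEq t1 t2 | FLt t1 t2 => vclosed V t1 && vclosed V t2
  | FNot p => fclosed V p
  | FAnd p q | FOr p q | FImp p q => fclosed V p && fclosed V q
  | FAll x p | FEx x p => fclosed (x :: V) p
  end.

(* Only numbers are ever substituted for variables, hence no capture can occur
   and no renaming of bound variables is needed. *)
Definition nsubst := var -> option nat.

Definition mask (s : nsubst) (x : var) : nsubst :=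
  fun y => if y == x then None else s y.

Definition nsubst_of (xs : seq var) (ns : seq nat) : nsubst :=
  fun y => if y \in xs then Some (nth 0 ns (index y xs)) else None.

Fixpoint vsubst (s : nsubst) (t : vterm) : vterm :=
  match t with
  | Num n => Num n
  | Var x => if s x is Some n then Num n else Var x
  | Plus t1 t2 => Plus (vsubst s t1) (vsubst s t2)
  end.

Fixpoint fsubst (s : nsubst) (phi : formula) : formula :=
  match phi with
  | FEq t1 t2 => FEq (vsubst s t1) (vsubst s t2)
  | FLt t1 t2 => FLt (vsubst s t1) (vsubst s t2)
  | FNot p => FNot (fsubst s p)
  | FAnd p q => FAnd (fsubst s p) (fsubst s q)
  | FOr p q => FOr (fsubst s p) (fsubst s q)
  | FImp p q => FImp (fsubst s p) (fsubst s q)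
  | FAll x p => FAll x (fsubst (mask s x) p)
  | FEx x p => FEx x (fsubst (mask s x) p)
  end.

(* [C] is the type of the identifiers of parametric definitions. *)
Inductive term (C : Type) :=
| Nil
| In of name & var & term C
| Out of name & vterm & term C
| Par of term C & term C
| Res of name & term C
| If of formula & term C
| Call of C & seq vterm.

Arguments Nil {C}.

Fixpoint tmap (C C' : Type) (f : C -> C') (T : term C) : term C' :=
  match T with
  | Nil => Nil
  | In a x T => In a x (tmap f T)
  | Out a t T => Out a t (tmap f T)
  | Par T1 T2 => Par (tmap f T1) (tmap f T2)
  | Res c T => Res c (tmap f T)
  | If phi T => If phi (tmap f T)
  | Call D ts => Call (f D) ts
  end.

Fixpoint tsubst (C : Type) (s : nsubst) (T : term C) : term C :=
  match T with
  | Nil => Nil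
  | In a x T => In a x (tsubst (mask s x) T)
  | Out a t T => Out a (vsubst s t) (tsubst s T)
  | Par T1 T2 => Par (tsubst s T1) (tsubst s T2)
  | Res c T => Res c (tsubst s T)
  | If phi T => If (fsubst s phi) (tsubst s T)
  | Call D ts => Call D (map (vsubst s) ts)
  end.

(* All free variables of [T] are in [V], and every call [D(t_1,..,t_k)] has the
   number [k] of arguments that [ar] prescribes for [D]. *)
Fixpoint twf (C : Type) (ar : C -> option nat) (V : seq var) (T : term C) :
    bool :=
  match T with
  | Nil => true
  | In _ x T => twf ar (x :: V) T
  | Out _ t T => vclosed V t && twf ar V T
  | Par T1 T2 => twf ar V T1 && twf ar V T2
  | Res _ T => twf ar V T
  | If phi T => fclosed V phi && twf ar V T
  | Call D ts => (ar D == Some (size ts)) && all (vclosed V) ts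
  end.

(* An equation [D(x_1,..,x_k) = T] is the pair of its parameters and its body;
   the definitions called in the body are designated by their positions in the
   finite (possibly mutually recursive) system the equation belongs to. *)
Definition equation : Type := seq var * term nat.
Definition system : Type := seq equation.

Definition sys_arity (S : system) (m : nat) : option nat :=
  omap (fun e : equation => size e.1) (onth S m).

Definition sys_wf (S : system) : bool :=
  all (fun e : equation => uniq e.1 && twf (sys_arity S) e.1 e.2) S.

(* The identifier of a parametric definition carries the system in which it is
   defined and its position there, so that all definitions coexist. *)
Definition ident : Type := system * nat.

Definition arity (D : ident) : option nat :=
  if sys_wf D.1 then sys_arity D.1 D.2 else None.

Record pdef (k : nat) :=
  PDef { pident :> ident; pdefP : arity pident == Some k }.

Definition link (S : system) (T : term nat) : term ident :=
  tmap (fun m => (S, m)) T.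

Definition process (P : term ident) : bool := twf arity [::] P.

Inductive action :=
| AIn of name & nat
| AOut of name & nat
| ATau.

Definition subject (l : action) : option name :=
  match l with AIn a _ | AOut a _ => Some a | ATau => None end.

(* There is no name passing, hence no scope extrusion and no need for
   conversion of local names. *)
Inductive step : term ident -> action -> term ident -> Prop :=
| step_in a x T n :
    step (In a x T) (AIn a n) (tsubst (nsubst_of [:: x] [:: n]) T)
| step_out a t T :
    step (Out a t T) (AOut a (value t)) T
| step_parl P l P' Q :
    step P l P' -> step (Par P Q) l (Par P' Q)
| step_parr P Q l Q' :
    step Q l Q' -> step (Par P Q) l (Par P Q')
| step_coml a n P P' Q Q' :
    step P (AIn a n) P' -> step Q (AOut a n) Q' ->
    step (Par P Q) ATau (Par P' Q')
| step_comr a n P P' Q Q' :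
    step P (AOut a n) P' -> step Q (AIn a n) Q' ->
    step (Par P Q) ATau (Par P' Q')
| step_res c P l P' :
    subject l <> Some c -> step P l P' -> step (Res c P) l (Res c P')
| step_if phi P l P' :
    valid phi -> step P l P' -> step (If phi P) l P'
| step_call S m xs T ts l P' :
    onth S m = Some (xs, T) ->
    step (tsubst (nsubst_of xs (map value ts)) (link S T)) l P' ->
    step (Call (S, m) ts) l P'.

Definition tau (P P' : term ident) : Prop := step P ATau P'.
Definition taus : relation (term ident) := clos_refl_trans _ tau.
Definition taup : relation (term ident) := clos_trans _ tau.

Definition converse (R : relation (term ident)) : relation (term ident) :=
  fun P Q => R Q P.

Definition observable (P : term ident) : Prop :=
  exists P' l P'', [/\ taus P P', l <> ATau & step P' l P''].

Definition on_processes (R : relation (term ident)) : Prop :=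
  forall P Q, R P Q -> process P /\ process Q.

Definition refl_on_processes (R : relation (term ident)) : Prop :=
  forall P, process P -> R P P.

Definition extensional (R : relation (term ident)) : Prop :=
  (forall c P Q, R P Q -> R (Res c P) (Res c Q)) /\
  (forall P Q P' Q', R P Q -> R P' Q' -> R (Par P P') (Par Q Q')).

Definition equipollent (R : relation (term ident)) : Prop :=
  forall P Q, R P Q -> (observable P <-> observable Q).

(* Codivergence in the sense of Priese: an infinite internal computation is
   matched, after finitely many of its steps, by a nonempty one. *)
Definition half_codivergent (R : relation (term ident)) : Prop :=
  forall P Q (p : nat -> term ident), R P Q ->
  p 0 = P -> (forall n, tau (p n) (p n.+1)) ->
  exists i Q', [/\ 0 < i, taup Q Q' & R (p i) Q'].

Definition codivergent (R : relation (term ident)) : Prop :=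
  half_codivergent R /\ half_codivergent (converse R).

(* Branching style: the step is either absorbed or matched by a step, in both
   cases after internal steps that stay related to the source. *)
Definition half_bisimulation (R : relation (term ident)) : Prop :=
  forall P Q P', R P Q -> tau P P' ->
  (exists Q', [/\ taus Q Q', R P Q' & R P' Q']) \/
  (exists Q'' Q', [/\ taus Q Q'', R P Q'', tau Q'' Q' & R P' Q']).

Definition bisimulation (R : relation (term ident)) : Prop :=
  half_bisimulation R /\ half_bisimulation (converse R).

Definition absolute (R : relation (term ident)) : Prop :=
  [/\ on_processes R, refl_on_processes R & extensional R] /\
  [/\ equipollent R, codivergent R & bisimulation R].

(* The largest such relation, as the union of all of them. *)
Definition abs_eq (P Q : term ident) : Prop :=
  exists R, absolute R /\ R P Q.

Definition pdef_eq (k : nat) (D D' : pdef k) : Prop :=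
  forall ns : k.-tuple nat,
    abs_eq (Call (D : ident) (map Num ns)) (Call (D' : ident) (map Num ns)).

(* The global names of a term; those of a call are the global names of the body
   of the called definition. *)
Inductive global_name (S : system) (a : name) : term nat -> Prop :=
| gn_in x T : global_name S a (In a x T)
| gn_in_cont b x T : global_name S a T -> global_name S a (In b x T)
| gn_out t T : global_name S a (Out a t T)
| gn_out_cont b t T : global_name S a T -> global_name S a (Out b t T)
| gn_parl T T' : global_name S a T -> global_name S a (Par T T')
| gn_parr T T' : global_name S a T' -> global_name S a (Par T T')
| gn_res c T : a <> c -> global_name S a T -> global_name S a (Res c T)
| gn_if phi T : global_name S a T -> global_name S a (If phi T)
| gn_call m ts xs T :
    onth S m = Some (xs, T) -> global_name S a T -> global_name S a (Call m ts).

Inductive local_name (S : system) (c : name) : term nat -> Prop :=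
| ln_res T : local_name S c (Res c T)
| ln_res_cont b T : local_name S c T -> local_name S c (Res b T)
| ln_in b x T : local_name S c T -> local_name S c (In b x T)
| ln_out b t T : local_name S c T -> local_name S c (Out b t T)
| ln_parl T T' : local_name S c T -> local_name S c (Par T T')
| ln_parr T T' : local_name S c T' -> local_name S c (Par T T')
| ln_if phi T : local_name S c T -> local_name S c (If phi T)
| ln_call m ts xs T :
    onth S m = Some (xs, T) -> local_name S c T -> local_name S c (Call m ts).

(* [[i, J]], where the list [J] of global names is in increasing order. *)
Definition has_type (D : ident) (i : nat) (J : seq name) : Prop :=
  exists xs T (L : seq name),
    [/\ onth D.1 D.2 = Some (xs, T),
        uniq L /\ size L = i, forall c, c \in L <-> local_name D.1 c T,
        sorted ltn J & forall a, a \in J <-> global_name D.1 a T].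

Definition pair_code (m n : nat) : nat := ((m + n) * (m + n).+1)./2 + n.

Fixpoint seq_code (s : seq nat) : nat :=
  if s is n :: s' then (pair_code n (seq_code s')).+1 else 0.

Fixpoint vterm_code (t : vterm) : nat :=
  match t with
  | Num n => 3 * n
  | Var x => 3 * x + 1
  | Plus t1 t2 => 3 * pair_code (vterm_code t1) (vterm_code t2) + 2
  end.

Fixpoint formula_code (phi : formula) : nat :=
  match phi with
  | FEq t1 t2 => 8 * pair_code (vterm_code t1) (vterm_code t2)
  | FLt t1 t2 => 8 * pair_code (vterm_code t1) (vterm_code t2) + 1
  | FNot p => 8 * formula_code p + 2
  | FAnd p q => 8 * pair_code (formula_code p) (formula_code q) + 3
  | FOr p q => 8 * pair_code (formula_code p) (formula_code q) + 4
  | FImp p q => 8 * pair_code (formula_code p) (formula_code q) + 5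
  | FAll x p => 8 * pair_code x (formula_code p) + 6
  | FEx x p => 8 * pair_code x (formula_code p) + 7
  end.

Fixpoint term_code (T : term nat) : nat :=
  match T with
  | Nil => 0
  | In a x T => 7 * pair_code a (pair_code x (term_code T)) + 1
  | Out a t T => 7 * pair_code a (pair_code (vterm_code t) (term_code T)) + 2
  | Par T1 T2 => 7 * pair_code (term_code T1) (term_code T2) + 3
  | Res c T => 7 * pair_code c (term_code T) + 4
  | If phi T => 7 * pair_code (formula_code phi) (term_code T) + 5
  | Call m ts => 7 * pair_code m (seq_code (map vterm_code ts)) + 6
  end.

Definition equation_code (e : equation) : nat :=
  pair_code (seq_code e.1) (term_code e.2).

Definition ident_code (D : ident) : nat :=
  pair_code (seq_code (map equation_code D.1)) D.2.

(* The number of a definition does not depend on its type: the numberings of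
   the various types are restrictions of a single one. With names coded
   relatively to the type, one number would denote at distinct types the
   renamings of one definition, and a union over all types, as in Rice's
   theorem, could be trivial for a non-trivial set of definitions. *)
Definition is_index (k i : nat) (J : seq name) (j : nat) : Prop :=
  exists D : pdef k, has_type D i J /\ ident_code D = j.

(* The system of [D] extended with [D_j(x_1,..,x_k) = D(j, x_1,..,x_k)]. *)
Definition fix_first (k j : nat) (D : ident) : ident :=
  (rcons D.1 (iota 0 k, Call D.2 (Num j :: map Var (iota 0 k))), size D.1).

Lemma sub_twf (C : Type) (ar ar' : C -> option nat) (V : seq var) (T : term C) :
  (forall D n, ar D = Some n -> ar' D = Some n) -> twf ar V T -> twf ar' V T.
Proof.
move=> sub; elim: T V => //=.
- by move=> _ x T IH V; apply: IH.
- by move=> _ t T IH V /andP[-> /IH].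
- by move=> T1 IH1 T2 IH2 V /andP[/IH1-> /IH2].
- by move=> phi T IH V /andP[-> /IH].
- by move=> D ts V /andP[/eqP/sub-> ->]; rewrite eqxx.
Qed.

Lemma sys_arity_rcons (S : system) (e : equation) (m n : nat) :
  sys_arity S m = Some n -> sys_arity (rcons S e) m = Some n.
Proof.
rewrite /sys_arity; elim: S m => [|e' S IH] [|m] //=; exact: IH.
Qed.

Lemma fix_firstP (k j : nat) (D : pdef k.+1) :
  arity (fix_first k j D) == Some k.
Proof.
case: D => -[S m]; rewrite /arity /fix_first /=.
case: ifP => // wfS /eqP arm; set e := (_, Call _ _).
have -> : sys_wf (rcons S e).
  rewrite /sys_wf all_rcons; apply/andP; split; last first.
    apply: sub_all wfS => e' /andP[-> /=]; apply: sub_twf.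
    exact: sys_arity_rcons.
  rewrite /= iota_uniq (sys_arity_rcons e arm) /= size_map size_iota eqxx.
  by rewrite all_map; apply/allP.
rewrite /sys_arity; have -> : onth (rcons S e) (size S) = Some e.
  by elim: (S) => //=.
by rewrite /= size_iota.
Qed.

Definition instance (k : nat) (D : pdef k.+1) (j : nat) : pdef k :=
  PDef (fix_firstP j D).

Definition universal (k : nat) (U : nat -> seq name -> pdef k.+1) : Prop :=
  forall i J (D : pdef k), has_type D i J ->
    pdef_eq (instance (U i J) (ident_code D)) D.

Inductive recfun :=
| RZero
| RSucc
| RProj of nat
| RComp of recfun & seq recfun
| RPrim of recfun & recfun
| RMu of recfun.

Inductive reval : recfun -> seq nat -> nat -> Prop :=
| reval_zero ns : reval RZero ns 0
| reval_succ n : reval RSucc [:: n] n.+1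
| reval_proj i ns : i < size ns -> reval (RProj i) ns (nth 0 ns i)
| reval_comp f gs ns ms m :
    revals gs ns ms -> reval f ms m -> reval (RComp f gs) ns m
| reval_prim0 f g ns m :
    reval f ns m -> reval (RPrim f g) (0 :: ns) m
| reval_primS f g n ns m m' :
    reval (RPrim f g) (n :: ns) m -> reval g [:: n, m & ns] m' ->
    reval (RPrim f g) (n.+1 :: ns) m'
| reval_mu f ns n (w : nat -> nat) :
    (forall i, i < n -> reval f (i :: ns) (w i).+1) -> reval f (n :: ns) 0 ->
    reval (RMu f) ns n
with revals : seq recfun -> seq nat -> seq nat -> Prop :=
| revals_nil ns : revals [::] ns [::]
| revals_cons g gs ns m ms :
    reval g ns m -> revals gs ns ms -> revals (g :: gs) ns (m :: ms).

Definition decidable_set (X : nat -> Prop) : Prop :=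
  exists f : recfun, forall n,
    (X n -> reval f [:: n] 1) /\ (~ X n -> reval f [:: n] 0).

(* Main.v *)
(** Suppose that [f] decides the index set. Pick [D0] in [B] and [D1] outside
[B]. By a diagonal construction there is a definition [E] that runs [f] on its own
code and then behaves as [D0] if the answer is 0, and as [D1] otherwise; either
answer contradicts the closure of [B] under absolute equality.

The definition [E] performs no internal step while it computes: recursive
functions are evaluated in continuation passing style by chains of unguarded
calls, which the operational semantics unfolds silently. Hence [E] is strongly
bisimilar to [D0] or [D1], and strong bisimilarity is contained in absolute
equality. *)

From Stdlib Require Import Relations Classical.
From mathcomp Require Import all_boot.
From mathcomp Require Import zify.
Require Import Defs.

Set Implicit Arguments.
Unset Strict Implicit.
Unset Printing Implicit Defensive.

(** * Strong bisimilarity and its congruence properties *)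

Definition simulation (R : relation (term ident)) : Prop :=
  forall P Q l P', R P Q -> step P l P' -> exists2 Q', step Q l Q' & R P' Q'.

Definition sbisim (P Q : term ident) : Prop :=
  exists R, [/\ simulation R, simulation (converse R) & R P Q].

Lemma sbisim_sym P Q : sbisim P Q -> sbisim Q P.
Proof. by case=> R [h1 h2 hR]; exists (converse R). Qed.

Lemma sbisim_step P Q l P' :
  sbisim P Q -> step P l P' -> exists2 Q', step Q l Q' & sbisim P' Q'.
Proof.
case=> R [h1 h2 hR] /(h1 _ _ _ _ hR) [Q' s hQ']; exists Q' => //.
by exists R.
Qed.

Lemma sbisim_coind (R : relation (term ident)) P Q :
  (forall A B, R A B -> R B A) -> simulation R -> R P Q -> sbisim P Q.
Proof.
move=> sym sim h; exists R; split=> // A B l A' /sym hAB /(sim _ _ _ _ hAB).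
by case=> B' s /sym; exists B'.
Qed.

(** The identity extended by the single pair of [P] and [Q] is a bisimulation: after one step both
    sides coincide. *)
Lemma eq_steps_sbisim P Q :
  (forall l P', step P l P' <-> step Q l P') -> sbisim P Q.
Proof.
move=> h; exists (fun A B => A = B \/ (A = P /\ B = Q)); split; last by right.
  by move=> A B l A' [<-|[-> ->]] s; exists A'; by [left|exact: s|apply/h].
by move=> A B l A' [<-|[-> ->]] s; exists A'; by [left|exact: s|apply/h].
Qed.

Lemma sbisim_refl P : sbisim P P.
Proof. exact: eq_steps_sbisim. Qed.

Lemma sbisim_trans Q P T : sbisim P Q -> sbisim Q T -> sbisim P T.
Proof.
move=> h1 h2; apply: (@sbisim_coind
  (fun A B => exists2 C, sbisim A C & sbisim C B)); last by exists Q.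
- by move=> A B [C /sbisim_sym hA /sbisim_sym hB]; exists C.
- move=> A B l A' [C hA hB] /(sbisim_step hA) [C' /(sbisim_step hB)].
  by case=> B' sB hC hA'; exists B' => //; exists C'.
Qed.

(** The last case covers both directions of a communication: its final component replays the
    synchronisation for any two terms that perform [l1] and [l2]. *)
Lemma step_parE P Q l T : step (Par P Q) l T ->
  [\/ exists2 P', step P l P' & T = Par P' Q,
      exists2 Q', step Q l Q' & T = Par P Q' |
      exists l1 l2 P' Q', [/\ step P l1 P', step Q l2 Q', T = Par P' Q' &
        forall A A' B B', step A l1 A' -> step B l2 B' ->
          step (Par A B) l (Par A' B')]].
Proof.
move=> s; inversion s as [| |A l0 P' B sP|A B l0 Q' sQ|a n A P' B Q' sP sQ
  |a n A P' B Q' sP sQ| | |]; subst.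
- by constructor 1; exists P'.
- by constructor 2; exists Q'.
- constructor 3; exists (AIn a n), (AOut a n), P', Q'; split=> // A1 A2 B1 B2.
  exact: (@step_coml a n).
- constructor 3; exists (AOut a n), (AIn a n), P', Q'; split=> // A1 A2 B1 B2.
  exact: (@step_comr a n).
Qed.

Lemma sbisim_par P Q P' Q' :
  sbisim P Q -> sbisim P' Q' -> sbisim (Par P P') (Par Q Q').
Proof.
move=> h h'; apply: (@sbisim_coind (fun A B => exists A1 A2 B1 B2,
  [/\ A = Par A1 A2, B = Par B1 B2, sbisim A1 B1 & sbisim A2 B2]));
  last by exists P, P', Q, Q'.
- move=> A B [A1 [A2 [B1 [B2 [-> -> /sbisim_sym h1 /sbisim_sym h2]]]]].
  by exists B1, B2, A1, A2.
move=> A B l A' [A1 [A2 [B1 [B2 [-> -> h1 h2]]]]].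
case/step_parE=> [[C sC ->]|[C sC ->]|[l1 [l2 [C1 [C2 [s1 s2 -> com]]]]]].
- have [C' sC' hC] := sbisim_step h1 sC.
  by exists (Par C' B2); [apply: step_parl | exists C, A2, C', B2].
- have [C' sC' hC] := sbisim_step h2 sC.
  by exists (Par B1 C'); [apply: step_parr | exists A1, C, B1, C'].
- have [C' sC' hC] := sbisim_step h1 s1.
  have [C'' sC'' hC'] := sbisim_step h2 s2.
  by exists (Par C' C''); [apply: com | exists C1, C2, C', C''].
Qed.

Lemma sbisim_res c P Q : sbisim P Q -> sbisim (Res c P) (Res c Q).
Proof.
move=> h; apply: (@sbisim_coind (fun A B => exists A1 B1,
  [/\ A = Res c A1, B = Res c B1 & sbisim A1 B1])); last by exists P, Q.
- by move=> A B [A1 [B1 [-> -> /sbisim_sym h1]]]; exists B1, A1.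
move=> A B l A' [A1 [B1 [-> -> h1]]] s.
inversion s as [| | | | | |c0 A0 l0 C nc sC| |]; subst.
have [C' sC' hC] := sbisim_step h1 sC.
by exists (Res c C'); [apply: step_res | exists C, C'].
Qed.

Lemma sbisim_par_dead P Q :
  (forall l Q', ~ step Q l Q') -> sbisim (Par P Q) P.
Proof.
move=> dead; exists (fun A B => A = Par B Q); split=> //.
  move=> A B l A' -> /step_parE[[C sC ->]|[C /dead]|[? [? [? [? [_ /dead]]]]]] //.
  by exists C.
by move=> A B l A' -> s; exists (Par A' Q) => //; apply: step_parl.
Qed.

Lemma sbisim_par_deadl P Q :
  (forall l Q', ~ step Q l Q') -> sbisim (Par Q P) P.
Proof.
move=> dead; exists (fun A B => A = Par Q B); split=> //.
  move=> A B l A' -> /step_parE[[C /dead]|[C sC ->]|[? [? [? [? [/dead]]]]]] //.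
  by exists C.
by move=> A B l A' -> s; exists (Par Q A') => //; apply: step_parr.
Qed.

Lemma step_callE S m ts l P' : step (Call (S, m) ts) l P' ->
  exists xs T, onth S m = Some (xs, T) /\
    step (tsubst (nsubst_of xs (map value ts)) (link S T)) l P'.
Proof.
move=> s; inversion s as [| | | | | | | |S0 m0 xs T ts0 l0 P0 hS sT]; subst.
by exists xs, T.
Qed.

Lemma if_dead phi P l P' : ~ valid phi -> ~ step (If phi P) l P'.
Proof. by move=> h s; inversion s. Qed.

Lemma sbisim_if phi P : valid phi -> sbisim (If phi P) P.
Proof.
move=> h; apply: eq_steps_sbisim => l P'; split=> [s|]; last exact: step_if.
by inversion s.
Qed.

(** A conditional is a parallel composition of guarded terms: a component with a false guard is
    inert forever and can be discarded. *)
Lemma sbisim_branch phi phi' P Q :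
  valid phi -> ~ valid phi' -> sbisim (Par (If phi P) (If phi' Q)) P.
Proof.
move=> h h'; apply: sbisim_trans (sbisim_if P h); apply: sbisim_par_dead.
by move=> l Q'; apply: if_dead.
Qed.

Lemma sbisim_branchr phi phi' P Q :
  ~ valid phi -> valid phi' -> sbisim (Par (If phi P) (If phi' Q)) Q.
Proof.
move=> h h'; apply: sbisim_trans (sbisim_if Q h'); apply: sbisim_par_deadl.
by move=> l Q'; apply: if_dead.
Qed.

(** Unfolding is not a transition: a call has exactly the transitions of the instantiated body.
    Chains of calls can thus compute without internal steps. *)
Lemma sbisim_unfold S m xs T ts : onth S m = Some (xs, T) ->
  sbisim (Call (S, m) ts) (tsubst (nsubst_of xs (map value ts)) (link S T)).
Proof.
move=> h; apply: eq_steps_sbisim => l P'; split; last exact: step_call.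
by case/step_callE=> xs' [T' []]; rewrite h => -[<- <-].
Qed.

Lemma sbisim_call_values (D : ident) ts ts' :
  map value ts = map value ts' -> sbisim (Call D ts) (Call D ts').
Proof.
case: D => S m h; apply: eq_steps_sbisim => l P'.
by split=> /step_callE [xs [T [hS]]] s; apply: (step_call hS); rewrite h in s *.
Qed.

(** * Substitution of numbers and preservation of well-formedness *)

Lemma vclosed_subst (s : nsubst) (V W : seq nat) t :
  (forall x, x \in V -> s x = None -> x \in W) ->
  vclosed V t -> vclosed W (vsubst s t).
Proof.
move=> h; elim: t => //= [x xV|t1 IH1 t2 IH2 /andP[/IH1-> /IH2->]] //.
by case E: (s x) => //=; apply: h.
Qed.

Lemma mask_closed (s : nsubst) (V W : seq nat) y :
  (forall x, x \in V -> s x = None -> x \in W) ->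
  forall x, x \in y :: V -> mask s y x = None -> x \in y :: W.
Proof.
move=> h x; rewrite /mask !inE; case: eqP => //= _; exact: h.
Qed.

Lemma fclosed_subst (s : nsubst) (V W : seq nat) phi :
  (forall x, x \in V -> s x = None -> x \in W) ->
  fclosed V phi -> fclosed W (fsubst s phi).
Proof.
elim: phi s V W => /=
  [t1 t2|t1 t2|p IH|p IHp q IHq|p IHp q IHq|p IHp q IHq|x p IH|x p IH] s V W h.
1,2: by move=> /andP[/(vclosed_subst h)-> /(vclosed_subst h)->].
- exact: IH.
1-3: by move=> /andP[/(IHp _ _ _ h)-> /(IHq _ _ _ h)->].
all: by apply: IH; apply: mask_closed.
Qed.

Lemma twf_subst (C : Type) (ar : C -> option nat) (s : nsubst) (V W : seq nat)
    (T : term C) :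
  (forall x, x \in V -> s x = None -> x \in W) ->
  twf ar V T -> twf ar W (tsubst s T).
Proof.
elim: T s V W => //=
  [a x T IH|a t T IH|T1 IH1 T2 IH2|phi T IH|D ts] s V W h.
- by apply: IH; apply: mask_closed.
- by move=> /andP[/(vclosed_subst h)-> /(IH _ _ _ h)->].
- by move=> /andP[/(IH1 _ _ _ h)-> /(IH2 _ _ _ h)->].
- by move=> /andP[/(fclosed_subst h)-> /(IH _ _ _ h)->].
- move=> /andP[/eqP-> cl]; rewrite size_map eqxx all_map /=.
  by apply: sub_all cl => t; apply: vclosed_subst.
Qed.

Lemma twf_tmap (C C' : Type) (f : C -> C') (ar : C' -> option nat) V T :
  twf ar V (tmap f T) = twf (ar \o f) V T.
Proof.
by elim: T V => //= [a t T IH|T1 IH1 T2 IH2|phi T IH] V;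
  rewrite ?IH ?IH1 ?IH2.
Qed.

Lemma tsubst_tmap (C C' : Type) (f : C -> C') s T :
  tsubst s (tmap f T) = tmap f (tsubst s T).
Proof.
by elim: T s => //= [a x T IH|a t T IH|T1 IH1 T2 IH2|a T IH|phi T IH] s;
  rewrite ?IH ?IH1 ?IH2.
Qed.

Lemma nsubst_of_None (xs : seq nat) ns x :
  x \in xs -> nsubst_of xs ns x = None -> x \in [::].
Proof. by rewrite /nsubst_of => ->. Qed.

Lemma onth_all (A : Type) (p : pred A) s i x :
  all p s -> onth s i = Some x -> p x.
Proof.
elim: s i => [|y s IH] [|i] //= /andP[py ps]; last exact: IH.
by case=> <-.
Qed.

(** [arity] is defined only on identifiers of well-formed systems, so a well-formed call guarantees
    that the called body is well formed. *)
Lemma process_step P l P' : step P l P' -> process P -> process P'.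
Proof.
rewrite /process; elim=> {P l P'} //=.
- move=> a x T n; apply: twf_subst => y; exact: nsubst_of_None.
- by move=> a t T /andP[].
- by move=> P l P' Q _ IH /andP[/IH-> ->].
- by move=> P Q l Q' _ IH /andP[-> /IH->].
- by move=> a n P P' Q Q' _ IH _ IH' /andP[/IH-> /IH'->].
- by move=> a n P P' Q Q' _ IH _ IH' /andP[/IH-> /IH'->].
- by move=> phi P l P' _ _ IH /andP[_ /IH].
move=> S m xs T ts l P' hS _ IH /andP[/eqP ar _]; apply: IH.
move: ar; rewrite /arity /=; case: ifP => // wfS _.
have /andP[_ wfT] := onth_all wfS hS.
(* The free variables of the body are parameters, and all of them are replaced. *)
apply: (twf_subst (V := xs)); first by move=> x; apply: nsubst_of_None.
rewrite twf_tmap; apply: sub_twf wfT => D n.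
by rewrite /= /arity /= wfS.
Qed.

(** * Strong bisimilarity is contained in absolute equality *)

Lemma sbisim_taus P Q P' :
  taus P P' -> sbisim P Q -> exists2 Q', taus Q Q' & sbisim P' Q'.
Proof.
move=> t; elim: t Q => {P P'} [P P' s Q h|P Q h|P P1 P2 _ IH1 _ IH2 Q h].
- have [Q' sQ hQ] := sbisim_step h s; exists Q' => //; exact: rt_step.
- by exists Q => //; apply: rt_refl.
- have [Q1 t1 /IH2 [Q2 t2 h2]] := IH1 _ h.
  by exists Q2 => //; apply: rt_trans t1 t2.
Qed.

Lemma sbisim_observable P Q : sbisim P Q -> observable P -> observable Q.
Proof.
move=> h [P' [l [P'' [t nl s]]]]; have [Q' tQ h'] := sbisim_taus t h.
by have [Q'' sQ _] := sbisim_step h' s; exists Q', l, Q''.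
Qed.

(** Strong bisimilarity restricted to processes is itself an absolute relation; the restriction is
    imposed by [on_processes] and survives steps by [process_step]. *)
Lemma sbisim_abs_eq P Q :
  process P -> process Q -> sbisim P Q -> abs_eq P Q.
Proof.
move=> wP wQ hPQ.
pose R A B := [/\ process A, process B & sbisim A B].
have symR A B : R A B -> R B A.
  by case=> wA wB /sbisim_sym.
have tauR A B A' : R A B -> tau A A' -> exists2 B', tau B B' & R A' B'.
  case=> wA wB h s; have [B' sB hB] := sbisim_step h s.
  by exists B' => //; split=> //; [apply: process_step s wA |
     apply: process_step sB wB].
(* The first step of the infinite computation is already matched, so the index 1 serves. *)
have cod : half_codivergent R.
  move=> A B p h p0 ps; have := ps 0; rewrite p0 => /(tauR _ _ _ h) [B' sB hB].
  by exists 1, B'; split=> //; apply: t_step.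
have bis : half_bisimulation R.
  move=> A B A' h s; right; have [B' sB hB] := tauR _ _ _ h s.
  by exists B, B'; split=> //; apply: rt_refl.
exists R; split; last by [].
split; split.
- by move=> A B [].
- by move=> A wA; split=> //; apply: sbisim_refl.
- split=> [c A B [wA wB h]|A B A' B' [wA wB h] [wA' wB' h']].
    by split=> //; apply: sbisim_res.
  by split; rewrite /process /=; [apply/andP|apply/andP|apply: sbisim_par].
- move=> A B [_ _ h]; split; apply: sbisim_observable => //.
  exact: sbisim_sym.
- split=> // A B p /symR h p0 ps; have [i [B' [i0 t /symR h']]] := cod _ _ _ h p0 ps.
  by exists i, B'.
- split=> // A B A' /symR h s.
  have [[B' [t /symR h1 /symR h2]]|[B1 [B' [t /symR h1 s' /symR h2]]]] :=
    bis _ _ _ h s; [left|right].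
    by exists B'.
  by exists B1, B'.
Qed.

(** Each half condition is paired with its converse, so the converse of an absolute relation is
    absolute. *)
Lemma abs_eq_sym P Q : abs_eq P Q -> abs_eq Q P.
Proof.
case=> R [[[onR reR [ext1 ext2]] [eqR [co1 co2] [bi1 bi2]]] h].
exists (converse R); split=> //; split; split=> //.
- by move=> A B /onR[].
- by split=> [c A B /ext1|A B A' B' h1 h2]; [exact | apply: ext2].
- by move=> A B /eqR[].
Qed.

Lemma pdef_eq_sym k (D D' : pdef k) : pdef_eq D D' -> pdef_eq D' D.
Proof. by move=> h ns; apply: abs_eq_sym. Qed.

Lemma process_call k (D : pdef k) (ns : k.-tuple nat) :
  process (Call (D : ident) (map Num ns)).
Proof.
rewrite /process /= size_map size_tuple (eqP (pdefP D)) eqxx all_map.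
exact/allP.
Qed.

Lemma sbisim_pdef_eq k (D D' : pdef k) :
  (forall ns, size ns = k ->
     sbisim (Call (D : ident) (map Num ns)) (Call (D' : ident) (map Num ns))) ->
  pdef_eq D D'.
Proof.
move=> h ns; apply: sbisim_abs_eq; try exact: process_call.
by apply: h; rewrite size_tuple.
Qed.

(** * Relocation of a system inside a larger one *)

Lemma tmap_comp (A B C : Type) (f : A -> B) (g : B -> C) T :
  tmap g (tmap f T) = tmap (g \o f) T.
Proof.
by elim: T => //= [a x T ->|a t T ->|T1 -> T2 ->|c T ->|phi T ->].
Qed.

Definition def_body (D : ident) : option (seq nat * term ident) :=
  omap (fun e : equation => (e.1, link D.1 e.2)) (onth D.1 D.2).

Lemma step_def D xs T ts l P' : def_body D = Some (xs, T) ->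
  step (tsubst (nsubst_of xs (map value ts)) T) l P' -> step (Call D ts) l P'.
Proof.
case: D => S m; rewrite /def_body /=; case E: (onth S m) => [[ys T']|] //=.
by case=> <- <-; apply: step_call E.
Qed.

(** [f] and [g] resolve the same call positions in two ways, both following the abstract bodies [b].
    A derivative of [tmap f T] is again an image under [tmap f], and the derivation survives
    replacing [f] by [g]. *)
Lemma step_tmap (b : nat -> option equation) (f g : nat -> ident) :
  (forall m, def_body (f m) = omap (fun e => (e.1, tmap f e.2)) (b m)) ->
  (forall m, def_body (g m) = omap (fun e => (e.1, tmap g e.2)) (b m)) ->
  forall P l P', step P l P' -> forall T, P = tmap f T ->
  exists2 T', P' = tmap f T' & step (tmap g T) l (tmap g T').
Proof.
move=> hf hg P l P'; elim=> {P l P'}.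
- move=> a x T0 n [] //= b' y T [-> -> ->].
  exists (tsubst (nsubst_of [:: y] [:: n]) T); rewrite -tsubst_tmap //.
  exact: step_in.
- move=> a t T0 [] //= b' u T [-> -> ->]; exists T => //; exact: step_out.
- move=> P l P' Q _ IH [] //= T1 T2 [/IH [T' -> s] ->].
  by exists (Par T' T2) => //=; apply: step_parl.
- move=> P Q l Q' _ IH [] //= T1 T2 [-> /IH [T' -> s]].
  by exists (Par T1 T') => //=; apply: step_parr.
- move=> a n P P' Q Q' _ IH1 _ IH2 [] //= T1 T2 [/IH1 [T1' -> s1]].
  by move=> /IH2 [T2' -> s2]; exists (Par T1' T2') => //=; apply: step_coml s2.
- move=> a n P P' Q Q' _ IH1 _ IH2 [] //= T1 T2 [/IH1 [T1' -> s1]].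
  by move=> /IH2 [T2' -> s2]; exists (Par T1' T2') => //=; apply: step_comr s2.
- move=> c P l P' nc _ IH [] //= c' T [<- /IH [T' -> s]].
  by exists (Res c T') => //=; apply: step_res.
- move=> phi P l P' v _ IH [] //= phi' T [<- /IH [T' -> s]].
  by exists T' => //=; apply: step_if.
move=> S m xs T0 ts l P' hS _ IH [] //= n us [fn <-].
have := hf n; rewrite /def_body -fn /= hS /=.
case E: (b n) => [[ys T]|] //= [exs eT].
case: (IH (tsubst (nsubst_of xs (map value ts)) T)).
  by rewrite eT tsubst_tmap.
move=> T' -> s; exists T' => //; apply: (@step_def _ xs (tmap g T)).
  by rewrite hg E /= exs.
by rewrite tsubst_tmap.
Qed.

(** The bisimulation pairs the two resolutions of one common term. Hence a system can be copied into
    a larger one under new positions without changing its behaviour. *)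
Lemma sbisim_relocate (S0 S : system) (r : nat -> nat) :
  (forall m, onth S (r m) =
     omap (fun e : equation => (e.1, tmap r e.2)) (onth S0 m)) ->
  forall m ts, sbisim (Call (S, r m) ts) (Call (S0, m) ts).
Proof.
move=> h m ts; pose f n : ident := (S0, n); pose g n : ident := (S, r n).
have hf n : def_body (f n) = omap (fun e => (e.1, tmap f e.2)) (onth S0 n).
  by [].
have hg n : def_body (g n) = omap (fun e => (e.1, tmap g e.2)) (onth S0 n).
  rewrite /def_body /= h; case: (onth S0 n) => //= e.
  by rewrite /link tmap_comp.
exists (fun P Q => exists2 T, P = tmap g T & Q = tmap f T); split.
- move=> P Q l P' [T hP ->] s; have [T' -> s'] := step_tmap hg hf s hP.
  by exists (tmap f T') => //; exists T'.
- move=> P Q l P' [T -> hP] s; have [T' -> s'] := step_tmap hf hg s hP.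
  by exists (tmap g T') => //; exists T'.
- by exists (Call m ts).
Qed.

(** * Equations as jumps and branches on registers *)

Definition vars (b n : nat) : seq vterm := map Var (iota b n).

(** Parameters are numbered from 0, so the variable [x] denotes position [x] of the argument list,
    which acts as a bank of registers. *)
Definition goto (N n : nat) (ts : seq vterm) : equation :=
  (iota 0 N, Call n ts).

Definition branch (N : nat) (t1 t2 : vterm) (n : nat) (ts : seq vterm)
    (n' : nat) (ts' : seq vterm) : equation :=
  (iota 0 N, Par (If (FEq t1 t2) (Call n ts))
                 (If (FNot (FEq t1 t2)) (Call n' ts'))).

Definition call (S : system) (m : nat) (ns : seq nat) : term ident :=
  Call (S, m) (map Num ns).

Lemma size_vars b n : size (vars b n) = n.
Proof. by rewrite size_map size_iota. Qed.

Lemma value_subst vals t :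
  value (vsubst (nsubst_of (iota 0 (size vals)) vals) t) =
  veval (nth 0 vals) t.
Proof.
elim: t => //= [x|t1 IH1 t2 IH2]; last by rewrite -IH1 -IH2.
rewrite /nsubst_of mem_iota add0n /=; case: ltnP => h.
  have := @index_uniq _ 0 x (iota 0 (size vals)).
  by rewrite size_iota nth_iota // add0n => -> //; rewrite iota_uniq.
(* Beyond the list the variable is left in place and [value] gives it 0, the default of [nth]. *)
by rewrite nth_default.
Qed.

Lemma map_value_subst vals ts :
  map value (map (vsubst (nsubst_of (iota 0 (size vals)) vals)) ts) =
  map (veval (nth 0 vals)) ts.
Proof. by rewrite -map_comp; apply: eq_map => t; apply: value_subst. Qed.

Lemma map_value_Num ns : map value (map Num ns) = ns.
Proof. by rewrite -map_comp map_id. Qed.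

Lemma call_subst S n ts vals :
  sbisim (tsubst (nsubst_of (iota 0 (size vals)) vals) (link S (Call n ts)))
         (call S n (map (veval (nth 0 vals)) ts)).
Proof.
by apply: sbisim_call_values; rewrite map_value_Num map_value_subst.
Qed.

Lemma call_goto S m N n ts vals vals' :
  onth S m = Some (goto N n ts) -> size vals = N ->
  map (veval (nth 0 vals)) ts = vals' ->
  sbisim (call S m vals) (call S n vals').
Proof.
move=> h hN <-; apply: sbisim_trans (sbisim_unfold _ h) _.
rewrite map_value_Num -hN; exact: call_subst.
Qed.

Lemma call_branch S m N t1 t2 n ts n' ts' vals vals' :
  onth S m = Some (branch N t1 t2 n ts n' ts') -> size vals = N ->
  veval (nth 0 vals) t1 = veval (nth 0 vals) t2 ->
  map (veval (nth 0 vals)) ts = vals' ->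
  sbisim (call S m vals) (call S n vals').
Proof.
move=> h hN ht <-; apply: sbisim_trans (sbisim_unfold _ h) _.
rewrite map_value_Num -hN; apply: sbisim_trans (call_subst _ _ _ _).
have e : valid (fsubst (nsubst_of (iota 0 (size vals)) vals) (FEq t1 t2)).
  by rewrite /valid /= -!/(value _) !value_subst.
exact: sbisim_branch.
Qed.

Lemma call_branchN S m N t1 t2 n ts n' ts' vals vals' :
  onth S m = Some (branch N t1 t2 n ts n' ts') -> size vals = N ->
  veval (nth 0 vals) t1 <> veval (nth 0 vals) t2 ->
  map (veval (nth 0 vals)) ts' = vals' ->
  sbisim (call S m vals) (call S n' vals').
Proof.
move=> h hN ht <-; apply: sbisim_trans (sbisim_unfold _ h) _.
rewrite map_value_Num -hN; apply: sbisim_trans (call_subst _ _ _ _).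
have e : ~ valid (fsubst (nsubst_of (iota 0 (size vals)) vals) (FEq t1 t2)).
  by rewrite /valid /= -!/(value _) !value_subst.
exact: sbisim_branchr.
Qed.

(** Copying, moving and dropping registers all reduce to reading contiguous segments. *)
Lemma eval_vars u v w vals b n :
  vals = u ++ v ++ w -> b = size u -> n = size v ->
  map (veval (nth 0 vals)) (vars b n) = v.
Proof.
move=> -> -> ->; rewrite -map_comp; apply: (@eq_from_nth _ 0).
  by rewrite size_map size_iota.
rewrite size_map size_iota => i hi.
rewrite (nth_map 0) ?size_iota //= nth_iota // nth_cat ltnNge leq_addr /=.
by rewrite addKn nth_cat hi.
Qed.

(** * Compilation of recursive functions into blocks of equations *)

Definition eq_wf (S : system) (e : equation) : bool :=
  uniq e.1 && twf (sys_arity S) e.1 e.2.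

Lemma vars_closed b n N : b + n <= N -> all (vclosed (iota 0 N)) (vars b n).
Proof.
move=> h; rewrite all_map; apply/allP => x /=.
rewrite !mem_iota; lia.
Qed.

Lemma goto_wf S N n ts :
  sys_arity S n = Some (size ts) -> all (vclosed (iota 0 N)) ts ->
  eq_wf S (goto N n ts).
Proof. by move=> h hts; rewrite /eq_wf /= iota_uniq h eqxx. Qed.

Lemma branch_wf S N t1 t2 n ts n' ts' :
  sys_arity S n = Some (size ts) -> sys_arity S n' = Some (size ts') ->
  vclosed (iota 0 N) t1 && vclosed (iota 0 N) t2 ->
  all (vclosed (iota 0 N)) ts -> all (vclosed (iota 0 N)) ts' ->
  eq_wf S (branch N t1 t2 n ts n' ts').
Proof.
rewrite /eq_wf /= iota_uniq => -> -> /andP[-> ->] -> ->.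
by rewrite !eqxx.
Qed.

(** Blocks are specified for any system that contains them at a given address, since the whole
    system is assembled only at the end. *)
Definition placed (b : seq equation) (base : nat) (S : system) : Prop :=
  forall i e, onth b i = Some e -> onth S (base + i) = Some e.

Lemma placed_cons e b base S : placed (e :: b) base S ->
  onth S base = Some e /\ placed b base.+1 S.
Proof.
move=> h; split; first by rewrite -[base]addn0; apply: h.
by move=> i e' hi; rewrite addSnnS; apply: h.
Qed.

Lemma onth_lt (T : Type) (s : seq T) i x : onth s i = Some x -> i < size s.
Proof. by move=> h; rewrite -onthTE h. Qed.

Lemma placed_cat b b' base S : placed (b ++ b') base S ->
  placed b base S /\ placed b' (base + size b) S.
Proof.
move=> h; split=> i e hi; last rewrite -addnA; apply: h; rewrite onth_cat.
  by rewrite (onth_lt hi).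
by rewrite ltnNge leq_addr addKn.
Qed.

Lemma onth_arity S m e : onth S m = Some e -> sys_arity S m = Some (size e.1).
Proof. by rewrite /sys_arity => ->. Qed.

(** [env] is data saved beneath the arguments: the block consumes [ns], puts the result on top of
    [env] and continues at [K]. Nothing is claimed where [f] has no value. *)
Definition implements S f a e base K : Prop :=
  forall ns m env, size ns = a -> size env = e -> reval f ns m ->
    sbisim (call S base (ns ++ env)) (call S K (m :: env)).

(* The code block of [f] may call the continuation [K], which lies outside. *)
Definition compilable (f : recfun) : Prop :=
  forall a e base K, exists b, forall S, placed b base S ->
    sys_arity S K = Some e.+1 ->
    [/\ all (eq_wf S) b, sys_arity S base = Some (a + e) &
        implements S f a e base K].

(** A basic function is one jump that computes the result in an argument. At an arity where [f] has
    no value this jump might read absent registers, so an inert equation can replace it to keep the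
    block well formed. *)
Lemma compile_goto f (ts : nat -> nat -> seq vterm) :
  (forall a e, size (ts a e) = e.+1) ->
  (forall a e, all (vclosed (iota 0 (a + e))) (ts a e) \/
     forall ns m, size ns = a -> ~ reval f ns m) ->
  (forall ns m env, reval f ns m ->
     map (veval (nth 0 (ns ++ env))) (ts (size ns) (size env)) = m :: env) ->
  compilable f.
Proof.
move=> sz cl ev a e base K; case: (cl a e) => [c|nr].
  exists [:: goto (a + e) K (ts a e)] => S /placed_cons [h _] hK.
  split.
  - by rewrite /= goto_wf // sz.
  - by rewrite (onth_arity h) size_iota.
  - move=> ns m env hns henv r; apply: (call_goto h).
      by rewrite size_cat hns henv.
    by rewrite -hns -henv; apply: ev.
exists [:: (iota 0 (a + e), @Nil nat)] => S /placed_cons [h _] hK; split.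
- by rewrite /= /eq_wf /= iota_uniq.
- by rewrite (onth_arity h) size_iota.
- by move=> ns m env /nr h' _ /h'.
Qed.

Lemma compile_zero : compilable RZero.
Proof.
apply: (@compile_goto _ (fun a e => Num 0 :: vars a e)) => [a e|a e|ns m env r].
- by rewrite /= size_vars.
- by left; rewrite /= vars_closed.
- inversion r; subst => /=; congr cons.
  by apply: (eval_vars (u := ns) (w := [::])); rewrite ?cats0.
Qed.

Lemma compile_succ : compilable RSucc.
Proof.
apply: (@compile_goto _ (fun a e => Plus (Var 0) (Num 1) :: vars a e))
  => [a e|[|a] e|ns m env r].
- by rewrite /= size_vars.
- by right=> -[|n ns] m //= _ r; inversion r.
- by left; apply/andP; split; last exact: vars_closed.
- inversion r; subst => /=; rewrite addn1; congr cons.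
  by apply: (eval_vars (u := [:: n]) (w := [::])); rewrite ?cats0.
Qed.

Lemma compile_proj i : compilable (RProj i).
Proof.
apply: (@compile_goto _ (fun a e => Var i :: vars a e)) => [a e|a e|ns m env r].
- by rewrite /= size_vars.
- case: (ltnP i a) => h; [left | right=> ns m hns r].
    by rewrite /= vars_closed // mem_iota /= add0n ltn_addr.
  by inversion r; subst; move: h; rewrite leqNgt H0.
- inversion r; subst => /=; rewrite nth_cat H0; congr cons.
  by apply: (eval_vars (u := ns) (w := [::])); rewrite ?cats0.
Qed.

Lemma revals_size gs ns ms : revals gs ns ms -> size ms = size gs.
Proof. by elim=> //= *; congr _.+1. Qed.

(** The functions are run from the last to the first, each result going on top of the previous ones,
    so the results end in order; [ns ++ env] stays beneath for later use. *)
Lemma compile_seq gs : (forall g, List.In g gs -> compilable g) ->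
  forall a e base K, exists b, forall S, placed b base S ->
    sys_arity S K = Some (size gs + (a + e)) ->
    [/\ all (eq_wf S) b, sys_arity S base = Some (a + e) &
        forall ns ms env, size ns = a -> size env = e -> revals gs ns ms ->
        sbisim (call S base (ns ++ env)) (call S K (ms ++ ns ++ env))].
Proof.
elim: gs => [|g gs IH] cg a e base K.
  exists [:: goto (a + e) K (vars 0 (a + e))] => S /placed_cons [h _] hK.
  split.
  - by rewrite /= goto_wf ?vars_closed // hK size_vars.
  - by rewrite (onth_arity h) size_iota.
  - move=> ns ms env hns henv r; inversion r; subst.
    apply: (call_goto h); first by rewrite size_cat.
    by apply: (eval_vars (u := [::]) (w := [::]));
      rewrite ?cats0 ?size_cat.
have {}IH := IH (fun g' h => cg g' (or_intror h)).
have {}cg : compilable g by apply: cg; left.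
(* [n1] counts the registers once the tail is done. Layout: the entry, a jump at [base.+1] copying
   [ns] to the top, the block of [g], the block of the tail. *)
pose n1 := size gs + (a + e).
have [bg hg] := cg a n1 base.+2 K.
have [b hb] := IH a e (base.+2 + size bg) base.+1.
exists [:: goto (a + e) (base.+2 + size bg) (vars 0 (a + e)),
           goto n1 base.+2 (vars (size gs) a ++ vars 0 n1) & bg ++ b] => S.
move=> /placed_cons [h0 /placed_cons [h1 /placed_cat [pg pb]]] hK.
have [wg ag ig] := hg S pg hK.
have a1 : sys_arity S base.+1 = Some n1 by rewrite (onth_arity h1) size_iota.
have [wb ab ib] := hb S pb a1.
split.
- rewrite /= all_cat wg wb !goto_wf //.
  + by rewrite size_cat !size_vars.
  + by rewrite all_cat !vars_closed // /n1; lia.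
  + by rewrite size_vars.
  + by rewrite vars_closed.
- by rewrite (onth_arity h0) size_iota.
move=> ns ms' env hns henv r; inversion r as [|g' gs' ns' m ms rg rgs]; subst.
have hms := revals_size rgs.
have hsz : size (ms ++ ns ++ env) = n1 by rewrite !size_cat hms.
apply: (sbisim_trans (call_goto h0 _ erefl)); first by rewrite size_cat.
rewrite (eval_vars (u := [::]) (v := ns ++ env) (w := [::])) ?cats0 ?size_cat //.
apply: (sbisim_trans (ib _ _ _ erefl erefl rgs)).
apply: sbisim_trans (ig _ _ _ erefl hsz rg).
apply: (call_goto h1) => //; rewrite map_cat.
rewrite (eval_vars (u := ms) (v := ns) (w := env)) //.
by rewrite (eval_vars (u := [::]) (v := ms ++ ns ++ env) (w := [::])) ?cats0.
Qed.

(** Once the arguments of [f] are computed, the jump at [base.+1] keeps them and [env] and drops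
    [ns]. *)
Lemma compile_comp f gs : compilable f ->
  (forall g, List.In g gs -> compilable g) -> compilable (RComp f gs).
Proof.
move=> cf cgs a e base K; pose n1 := size gs + (a + e).
have [bf hf] := cf (size gs) e base.+2 K.
have [b hb] := compile_seq cgs a e (base.+2 + size bf) base.+1.
exists [:: goto (a + e) (base.+2 + size bf) (vars 0 (a + e)),
           goto n1 base.+2 (vars 0 (size gs) ++ vars (size gs + a) e)
           & bf ++ b] => S.
move=> /placed_cons [h0 /placed_cons [h1 /placed_cat [pf pb]]] hK.
have [wf af i_f] := hf S pf hK.
have a1 : sys_arity S base.+1 = Some n1 by rewrite (onth_arity h1) size_iota.
have [wb ab ib] := hb S pb a1.
split.
- rewrite /= all_cat wf wb !goto_wf //.
  + by rewrite size_cat !size_vars.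
  + by rewrite all_cat !vars_closed // /n1; lia.
  + by rewrite size_vars.
  + by rewrite vars_closed.
- by rewrite (onth_arity h0) size_iota.
move=> ns m env hns henv r; inversion r as [| | |f' gs' ns' ms m' rgs rf| | |].
subst; have hms := revals_size rgs.
apply: (sbisim_trans (call_goto h0 _ erefl)); first by rewrite size_cat.
rewrite (eval_vars (u := [::]) (v := ns ++ env) (w := [::])) ?cats0 ?size_cat //.
apply: (sbisim_trans (ib _ _ _ erefl erefl rgs)).
apply: sbisim_trans (i_f _ _ _ hms erefl rf).
apply: (call_goto h1); first by rewrite !size_cat hms.
rewrite map_cat (eval_vars (u := [::]) (v := ms) (w := ns ++ env)) //.
by rewrite (eval_vars (u := ms ++ ns) (v := env) (w := [::]))
  ?cats0 ?catA ?size_cat ?hms.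
Qed.

(** A counting loop on the registers [[:: i, r, n & ns ++ env]], where [r] is the value of the
    recursion at [i]; it exits when [i] equals [n]. *)
Lemma compile_prim f g :
  compilable f -> compilable g -> compilable (RPrim f g).
Proof.
move=> cf cg [|a] e base K.
  exists [:: (iota 0 e, @Nil nat)] => S /placed_cons [h _] hK; split.
  - by rewrite /= /eq_wf /= iota_uniq.
  - by rewrite (onth_arity h) size_iota.
  - by move=> [|n ns] m env //= _ _ r; inversion r.
(* Layout: [base] calls [f], [base.+1] sets the counter to 0, [base.+2] tests it, [base.+3]
   increments it after [g]; then come the blocks of [g] and [f]. The data saved across [f] and [g]
   are [n :: ns ++ env] and [i :: n :: ns ++ env], whence the sizes. *)
have [bg hg] := cg a.+2 (a + e).+2 base.+4 base.+3.
have [bf hf] := cf a (a + e).+1 (base.+4 + size bg) base.+1.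
exists [:: goto (a + e).+1 (base.+4 + size bg) (vars 1 a ++ vars 0 (a + e).+1),
  goto (a + e).+2 base.+2 (Num 0 :: vars 0 (a + e).+2),
  branch (a + e).+3 (Var 0) (Var 2) K (Var 1 :: vars a.+3 e)
    base.+4 ([:: Var 0; Var 1] ++ vars 3 a ++ Var 0 :: vars 2 (a + e).+1),
  goto (a + e).+3 base.+2 [:: Plus (Var 1) (Num 1), Var 0 & vars 2 (a + e).+1]
  & bg ++ bf] => S.
move=> /placed_cons [h0 /placed_cons [h1 /placed_cons [h2 /placed_cons [h3]]]].
move=> /placed_cat [pg pf] hK.
have a1 : sys_arity S base.+1 = Some (a + e).+2.
  by rewrite (onth_arity h1) size_iota.
have a2 : sys_arity S base.+2 = Some (a + e).+3.
  by rewrite (onth_arity h2) size_iota.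
have a3 : sys_arity S base.+3 = Some (a + e).+3.
  by rewrite (onth_arity h3) size_iota.
have [wg ag ig] := hg S pg a3.
have [wf af i_f] := hf S pf a1.
split.
- have c3 n b : b + n <= (a + e).+3 ->
    all (vclosed (iota 0 (a + e).+3)) (vars b n) by exact: vars_closed.
  have wgf : all (eq_wf S) (bg ++ bf) by rewrite all_cat wg.
  apply/and5P; split=> //.
  + apply: goto_wf; first by rewrite af size_cat !size_vars.
    by rewrite all_cat !vars_closed //; lia.
  + apply: goto_wf; first by rewrite a2 /= size_map size_iota.
    by apply/andP; split=> //; apply: vars_closed.
  + apply: branch_wf; first by rewrite hK /= size_vars.
      rewrite ag; congr Some; rewrite !size_cat size_vars /= size_map size_iota.
      by lia.
    + by [].
    + by apply/andP; split; last by apply: c3; lia.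
    + rewrite 2!all_cat; apply/and3P; split=> //; first by apply: c3; lia.
      by apply/andP; split; last exact: (c3 (a + e).+1 2).
  + apply: goto_wf; first by rewrite a2 /= size_map size_iota.
    by apply/and3P; split=> //; apply: (c3 (a + e).+1 2).
- by rewrite (onth_arity h0) size_iota.
move=> [|n ns] m env //= [hns] henv r.
have hsz : size (ns ++ env) = a + e by rewrite size_cat hns henv.
(* The loop invariant; the bound on [i] makes the exit test fail in every earlier round. *)
have loop i m' : i <= n -> reval (RPrim f g) (i :: ns) m' ->
    sbisim (call S base (n :: ns ++ env))
           (call S base.+2 [:: i, m', n & ns ++ env]).
  elim: i m' => [|i IH] m' hi ri.
    inversion ri as [| | | |f' g' ns' m0 rf| |]; subst.
    apply: (sbisim_trans (call_goto h0 _ erefl)); first by rewrite /= size_cat.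
    rewrite map_cat (eval_vars (u := [:: n]) (v := ns) (w := env)) //.
    rewrite (eval_vars (u := [::]) (v := n :: ns ++ env) (w := [::])) ?cats0 //=;
      last by rewrite hsz.
    apply: (sbisim_trans (i_f _ _ _ erefl _ rf)); first by rewrite /= hsz.
    apply: (call_goto h1); first by rewrite /= hsz.
    rewrite map_cons; congr cons.
    by apply: (eval_vars (u := [::]) (w := [::])); rewrite ?cats0 /= ?hsz.
  inversion ri as [| | | | |f' g' n' ns' m0 m1 r0 rg|]; subst.
  apply: (sbisim_trans (IH _ (ltnW hi) r0)).
  apply: (@sbisim_trans (call S base.+3 [:: m', i, n & ns ++ env])).
    apply: sbisim_trans (ig [:: i, m0 & ns] _ (i :: n :: ns ++ env) erefl _ rg);
      last by rewrite /= hsz.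
    apply: (call_branchN h2); rewrite /= ?hsz //; first by lia.
    rewrite map_cat (eval_vars (u := [:: i; m0; n]) (v := ns) (w := env)) //=.
    congr [:: i, m0 & ns ++ [:: i, n & _]].
    by apply: (eval_vars (u := [:: i; m0; n]) (w := [::]));
      rewrite ?cats0 ?hsz.
  apply: (call_goto h3); first by rewrite /= hsz.
  rewrite /= addn1; do 3!congr cons.
  by apply: (eval_vars (u := [:: m'; i; n]) (w := [::])); rewrite ?cats0 ?hsz.
apply: (sbisim_trans (loop n m (leqnn n) r)).
apply: (call_branch h2); rewrite /= ?hsz //; congr cons.
by apply: (eval_vars (u := [:: n, m, n & ns]) (w := [::]));
  rewrite ?cats0 //= hns.
Qed.

(** A search loop: [base.+1] runs [f] on the candidate [i], and [base.+2] exits with [i] if the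
    value is 0 and otherwise tries the next candidate. *)
Lemma compile_mu f : compilable f -> compilable (RMu f).
Proof.
move=> cf a e base K.
have [b hb] := cf a.+1 (a + e).+1 base.+3 base.+2.
exists [:: goto (a + e) base.+1 (Num 0 :: vars 0 (a + e)),
  goto (a + e).+1 base.+3 (vars 0 a.+1 ++ vars 0 (a + e).+1),
  branch (a + e).+2 (Var 0) (Num 0) K (Var 1 :: vars a.+2 e)
    base.+1 (Plus (Var 1) (Num 1) :: vars 2 (a + e)) & b] => S.
move=> /placed_cons [h0 /placed_cons [h1 /placed_cons [h2 pb]]] hK.
have a1 : sys_arity S base.+1 = Some (a + e).+1.
  by rewrite (onth_arity h1) size_iota.
have a2 : sys_arity S base.+2 = Some (a + e).+2.
  by rewrite (onth_arity h2) size_iota.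
have [wb ab ib] := hb S pb a2.
split.
- apply/and4P; split=> //.
  + apply: goto_wf; first by rewrite a1 /= size_vars.
    by apply/andP; split=> //; apply: vars_closed.
  + apply: goto_wf; first by rewrite ab size_cat !size_vars.
    by rewrite all_cat !vars_closed //; lia.
  + apply: branch_wf; first by rewrite hK /= size_vars.
      by rewrite a1 /= size_vars.
    + by [].
    + by apply/andP; split; last exact: (@vars_closed a.+2 e).
    + by apply/andP; split; last exact: (@vars_closed 2 (a + e)).
- by rewrite (onth_arity h0) size_iota.
move=> ns n env hns henv r; inversion r as [| | | | | |f' ns' n' w rw r0]; subst.
have test i v : reval f (i :: ns) v ->
    sbisim (call S base.+1 (i :: ns ++ env))
           (call S base.+2 [:: v, i & ns ++ env]).
  move=> ri; apply: sbisim_trans (ib (i :: ns) _ (i :: ns ++ env) erefl _ ri);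
    last by rewrite /= size_cat.
  apply: (call_goto h1); first by rewrite /= size_cat.
  rewrite map_cat (eval_vars (u := [::]) (v := i :: ns) (w := env)) //.
  by rewrite (eval_vars (u := [::]) (v := i :: ns ++ env) (w := [::]))
    ?cats0 //= size_cat.
(* The search reaches every candidate up to [n], as the values below [n] are positive by [rw]. *)
have loop i : i <= n ->
    sbisim (call S base (ns ++ env)) (call S base.+1 (i :: ns ++ env)).
  elim: i => [_|i IH hi].
    apply: (call_goto h0); first by rewrite size_cat.
    rewrite map_cons; congr cons.
    by apply: (eval_vars (u := [::]) (w := [::])); rewrite ?cats0 ?size_cat.
  apply: (sbisim_trans (IH (ltnW hi))); apply: (sbisim_trans (test _ _ (rw _ hi))).
  apply: (call_branchN h2); rewrite /= ?size_cat ?addn1 //; congr cons.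
  by apply: (eval_vars (u := [:: (w i).+1; i]) (w := [::]));
    rewrite ?cats0 ?size_cat.
apply: (sbisim_trans (loop n (leqnn n))); apply: (sbisim_trans (test _ _ r0)).
apply: (call_branch h2); rewrite /= ?size_cat //; congr cons.
by apply: (eval_vars (u := [:: 0, n & ns]) (w := [::])); rewrite ?cats0.
Qed.

(** [recfun] is nested in lists, so the recursion is explicit, with an inner induction on the list
    of a composition. *)
Lemma recfun_compilable f : compilable f.
Proof.
move: f; fix IH 1 => -[||i|f gs|f g|f].
- exact: compile_zero.
- exact: compile_succ.
- exact: compile_proj.
- apply: compile_comp; first exact: IH.
  by elim: gs => [|g gs IHgs] h; case=> [<-|]; [exact: IH|exact: IHgs].
- by apply: compile_prim; apply: IH.
- by apply: compile_mu; apply: IH.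
Qed.

(** * Recursiveness of the coding functions *)

Definition computable (h : nat -> nat) : Prop :=
  exists f, forall n, reval f [:: n] (h n).

Lemma reval_comp1 f g ns n m :
  reval g ns n -> reval f [:: n] m -> reval (RComp f [:: g]) ns m.
Proof.
by move=> hg hf; apply: reval_comp hf; do ?constructor.
Qed.

Lemma reval_comp2 f g g' ns n n' m :
  reval g ns n -> reval g' ns n' -> reval f [:: n; n'] m ->
  reval (RComp f [:: g; g']) ns m.
Proof.
by move=> hg hg' hf; apply: reval_comp hf; do ?constructor.
Qed.

Lemma reval_proj0 n ns : reval (RProj 0) (n :: ns) n.
Proof. exact: (@reval_proj 0 (n :: ns)). Qed.

Lemma reval_proj1 n n' ns : reval (RProj 1) [:: n, n' & ns] n'.
Proof. exact: (@reval_proj 1 [:: n, n' & ns]). Qed.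

Lemma recursive_add : exists f, forall m n, reval f [:: m; n] (m + n).
Proof.
exists (RPrim (RProj 0) (RComp RSucc [:: RProj 1])); elim=> [|m IH] n.
  apply: reval_prim0; exact: reval_proj0.
apply: reval_primS (IH n) _; apply: reval_comp1 (reval_proj1 _ _ _) _.
exact: reval_succ.
Qed.

(** Triangular numbers: [pair_code m n] is Cantor's pairing [tri (m + n) + n]. *)
Definition tri (n : nat) : nat := (n * n.+1)./2.

Lemma triS n : tri n.+1 = n.+1 + tri n.
Proof.
have e : n.+1 * n.+2 = n.+1.*2 + n * n.+1 by lia.
by rewrite /tri e halfD odd_double doubleK.
Qed.

Lemma recursive_tri : exists f, forall n, reval f [:: n] (tri n).
Proof.
have [radd hadd] := recursive_add.
exists (RPrim RZero (RComp radd [:: RComp RSucc [:: RProj 0]; RProj 1])).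
elim=> [|n IH]; first by apply: reval_prim0; apply: reval_zero.
apply: reval_primS IH _; rewrite triS; apply: reval_comp2 (hadd _ _).
  apply: reval_comp1 (reval_proj0 _ _) _; exact: reval_succ.
exact: reval_proj1.
Qed.

Lemma computable_id : computable id.
Proof. by exists (RProj 0) => n; apply: reval_proj0. Qed.

Lemma computable_succ h : computable h -> computable (fun n => (h n).+1).
Proof.
case=> f hf; exists (RComp RSucc [:: f]) => n.
apply: reval_comp1 (hf n) _; exact: reval_succ.
Qed.

Lemma computable_const c : computable (fun=> c).
Proof.
elim: c => [|c IH]; last exact: computable_succ.
by exists RZero => n; apply: reval_zero.
Qed.

Lemma computable_add h h' :
  computable h -> computable h' -> computable (fun n => h n + h' n).
Proof.
move=> [f hf] [f' hf']; have [radd hadd] := recursive_add.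
by exists (RComp radd [:: f; f']) => n; apply: reval_comp2 (hf n) (hf' n) _.
Qed.

Lemma computable_mulc c h : computable h -> computable (fun n => c * h n).
Proof.
move=> hh; elim: c => [|c IH]; first exact: computable_const.
exact: computable_add hh IH.
Qed.

Lemma computable_pair h h' :
  computable h -> computable h' -> computable (fun n => pair_code (h n) (h' n)).
Proof.
move=> ch ch'; apply: computable_add => //.
have [f hf] := computable_add ch ch'; have [ft hft] := recursive_tri.
by exists (RComp ft [:: f]) => n; apply: reval_comp1 (hf n) (hft _).
Qed.

(** * Injectivity of the codes *)

Lemma leq_tri m n : m <= n -> tri m <= tri n.
Proof.
elim: n => [|n IH]; first by case: m.
by rewrite leq_eqVlt ltnS => /orP[/eqP->|/IH] //; rewrite triS; lia.
Qed.

(** Codes of pairs with sum [d] lie between [tri d] and [tri d.+1], the latter excluded, so distinct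
    sums give disjoint ranges. *)
Lemma pair_code_inj m n m' n' :
  pair_code m n = pair_code m' n' -> m = m' /\ n = n'.
Proof.
rewrite /pair_code -!/(tri _) => e.
have := @leq_tri (m + n).+1 (m' + n'); have := @leq_tri (m' + n').+1 (m + n).
rewrite !triS; case: (ltngtP (m + n) (m' + n')) => h; try by lia.
by move: e; rewrite h; lia.
Qed.

Lemma seq_code_inj : injective seq_code.
Proof.
elim=> [|n s IH] [|n' s'] //= [].
by case/pair_code_inj=> -> /IH ->.
Qed.

(** The remainder modulo 3 identifies the constructor; formulas and terms are decoded likewise
    modulo 8 and 7. *)
Lemma vterm_code_inj : injective vterm_code.
Proof.
elim=> [n|x|t1 IH1 t2 IH2] [n'|x'|t1' t2'] /= e; try lia.
- congr Num; lia.
- congr Var; lia.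
- have /pair_code_inj[/IH1-> /IH2->] // :
    pair_code (vterm_code t1) (vterm_code t2) =
    pair_code (vterm_code t1') (vterm_code t2') by lia.
Qed.

Lemma formula_code_inj : injective formula_code.
Proof.
have inj r m n m' n' : 8 * pair_code m n + r = 8 * pair_code m' n' + r ->
  m = m' /\ n = n' by move=> e; apply: pair_code_inj; lia.
elim=> [t1 t2|t1 t2|p IH|p IHp q IHq|p IHp q IHq|p IHp q IHq|x p IH|x p IH];
  case=> [t1' t2'|t1' t2'|p'|p' q'|p' q'|p' q'|x' p'|x' p'] /= e; try lia.
- move: e; rewrite -[LHS]addn0 -[RHS]addn0.
  by case/inj=> /vterm_code_inj-> /vterm_code_inj->.
- by case: (inj _ _ _ _ _ e) => /vterm_code_inj-> /vterm_code_inj->.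
- by congr FNot; apply: IH; lia.
1-3: by case: (inj _ _ _ _ _ e) => /IHp-> /IHq->.
all: by case: (inj _ _ _ _ _ e) => -> /IH->.
Qed.

Lemma term_code_inj : injective term_code.
Proof.
have inj r m n m' n' : 7 * pair_code m n + r = 7 * pair_code m' n' + r ->
  m = m' /\ n = n' by move=> e; apply: pair_code_inj; lia.
elim=> [|a x T IH|a t T IH|T1 IH1 T2 IH2|c T IH|phi T IH|m ts];
  case=> [|a' x' T'|a' t' T'|T1' T2'|c' T'|phi' T'|m' ts'] //= e; try lia;
  have [e1 e2] := inj _ _ _ _ _ e.
- by have [-> /IH->] := pair_code_inj e2; rewrite e1.
- by have [/vterm_code_inj-> /IH->] := pair_code_inj e2; rewrite e1.
- by rewrite (IH1 _ e1) (IH2 _ e2).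
- by rewrite e1 (IH _ e2).
- by rewrite (formula_code_inj e1) (IH _ e2).
- by rewrite e1 (inj_map vterm_code_inj (seq_code_inj e2)).
Qed.

Lemma ident_code_inj : injective ident_code.
Proof.
case=> [S m] [S' m'] /pair_code_inj[/seq_code_inj/inj_map h /= ->].
congr pair; apply: h => -[xs T] [xs' T'].
by case/pair_code_inj=> /seq_code_inj /= -> /term_code_inj /= ->.
Qed.

(** The arity proof is a boolean equality, hence unique, so an index determines its definition. *)
Lemma pdef_code_inj k (D D' : pdef k) : ident_code D = ident_code D' -> D = D'.
Proof.
move=> /ident_code_inj; case: D D' => [D hD] [D' hD'] /= e.
by case: D' / e hD' => hD'; rewrite (bool_irrelevance hD hD').
Qed.

(** * Every definition has a type *)

Lemma sorted_enumeration (P : nat -> Prop) (s : seq nat) :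
  (forall n, P n -> n \in s) ->
  exists2 L : seq nat, sorted ltn L & forall n, n \in L <-> P n.
Proof.
move=> hs.
have [L hL] : exists L : seq nat, forall n, n \in L <-> n \in s /\ P n.
  elim: s {hs} => [|m s [L hL]]; first by exists [::] => n; split=> // -[].
  (* [P] comes with no decision procedure; classical logic selects its members from the finite bound
     [s]. *)
  have [Pm|nPm] := classic (P m); [exists (m :: L) | exists L] => n.
    rewrite !inE; split; first by case/orP=> [/eqP->|/hL[-> Pn]];
      rewrite ?eqxx ?orbT.
    by case=> /orP[->|ns Pn] //; apply/orP; right; apply/hL.
  split; first by case/hL=> ns Pn; rewrite inE ns orbT.
  by case; rewrite inE => /orP[/eqP-> /nPm|ns Pn] //; apply/hL.
exists (sort leq (undup L)).
  rewrite ltn_sorted_uniq_leq sort_uniq undup_uniq sort_sorted //.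
  exact: leq_total.
move=> n; rewrite mem_sort mem_undup; split=> [/hL[]|Pn] //.
by apply/hL; split=> //; apply: hs.
Qed.

(** An upper bound for both local and global names; calls add nothing because [sys_names] collects
    the names of all bodies. *)
Fixpoint names (T : term nat) : seq nat :=
  match T with
  | Nil => [::]
  | In a _ T | Out a _ T | Res a T => a :: names T
  | Par T1 T2 => names T1 ++ names T2
  | If _ T => names T
  | Call _ _ => [::]
  end.

Definition sys_names (S : system) : seq nat :=
  flatten [seq names e.2 | e <- S].

Lemma mem_sys_names (S : system) m xs T a : onth S m = Some (xs, T) ->
  a \in names T ++ sys_names S -> a \in sys_names S.
Proof.
move=> h; rewrite mem_cat => /orP[] //.
elim: S m h => [|e S IH] [|m] //= h; rewrite /sys_names /= mem_cat => aT.
  by case: h => e'; rewrite e' aT.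
by rewrite (IH _ h aT) orbT.
Qed.

Lemma global_name_mem S a T :
  global_name S a T -> a \in names T ++ sys_names S.
Proof.
elim=> {T} //=; try by move=> *; rewrite inE ?eqxx //; apply/orP; right.
- by move=> T T' _; rewrite !mem_cat => /orP[]->; rewrite ?orbT.
- by move=> T T' _; rewrite !mem_cat => /orP[]->; rewrite ?orbT.
- by move=> m ts xs T h _; apply: mem_sys_names h.
Qed.

Lemma local_name_mem S a T :
  local_name S a T -> a \in names T ++ sys_names S.
Proof.
elim=> {T} //=; try by move=> *; rewrite inE ?eqxx //; apply/orP; right.
- by move=> T T' _; rewrite !mem_cat => /orP[]->; rewrite ?orbT.
- by move=> T T' _; rewrite !mem_cat => /orP[]->; rewrite ?orbT.
- by move=> m ts xs T h _; apply: mem_sys_names h.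
Qed.

Lemma pdef_equation k (D : pdef k) :
  exists xs T, onth (pident D).1 (pident D).2 = Some (xs, T) /\ size xs = k.
Proof.
have /eqP := pdefP D; rewrite /arity /sys_arity; case: ifP => // _.
by case: (onth _ _) => //= -[xs T] [<-]; exists xs, T.
Qed.

Lemma pdef_has_type k (D : pdef k) : exists i J, has_type D i J.
Proof.
have [xs [T [h _]]] := pdef_equation D.
have [L sL hL] := sorted_enumeration (fun c => @local_name_mem (pident D).1 c T).
have [J sJ hJ] := sorted_enumeration (fun c => @global_name_mem (pident D).1 c T).
exists (size L), J, xs, T, L; split=> //.
by split=> //; apply: sorted_uniq sL; [apply: ltn_trans | apply: ltnn].
Qed.

(** * The diagonal definition and undecidability *)

Definition rename_calls (r : nat -> nat) (e : equation) : equation :=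
  (e.1, tmap r e.2).

(** Positions outside [S0] are sent just past the end of [S], so both lookups fail there and the
    equation holds for every [m]. *)
Lemma onth_relocated (A S0 B : system) (r : nat -> nat) :
  let S := A ++ map (rename_calls r) S0 ++ B in
  r =1 (fun m => if m < size S0 then size A + m else size S) ->
  forall m, onth S (r m) = omap (rename_calls r) (onth S0 m).
Proof.
move=> S hr m; rewrite hr; case: ltnP => hm.
  by rewrite onth_cat ltnNge leq_addr addKn onth_cat size_map hm onth_map.
by rewrite !onth_default.
Qed.

Lemma relocated_wf (S0 S : system) (r : nat -> nat) : sys_wf S0 ->
  (forall m, onth S (r m) = omap (rename_calls r) (onth S0 m)) ->
  all (eq_wf S) (map (rename_calls r) S0).
Proof.
move=> wf hr; rewrite all_map; apply: sub_all wf => e /andP[u w].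
rewrite /= /eq_wf /= u twf_tmap; apply: sub_twf w => m n.
by rewrite /= /sys_arity hr; case: (onth S0 m).
Qed.

(* The main equation passes the code [p] of the remaining equations to a program
   that rebuilds from [p] the code of the whole system and runs [f] on it. *)
Lemma self_referential_pdef k (f : recfun) (D0 D1 : pdef k) :
  exists E : pdef k,
    (reval f [:: ident_code E] 0 -> pdef_eq E D0) /\
    (forall n, reval f [:: ident_code E] n.+1 -> pdef_eq E D1).
Proof.
have [xs0 [T0 [eD0 sz0]]] := pdef_equation D0.
have [xs1 [T1 [eD1 sz1]]] := pdef_equation D1.
have wf_of (D : pdef k) : sys_wf (pident D).1.
  by have := pdefP D; rewrite /arity; case: ifP.
pose main p := goto k 2 (Num p :: vars 0 k).
(* The code of position 0 in a system with head [main p] whose other equations have code [p]. It is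
   recursive in [p], which occurs in [main p] only as a numeral. *)
pose code p := pair_code (pair_code (equation_code (main p)) p).+1 0.
have [fc hfc] : computable code.
  apply: computable_pair (computable_const _); apply: computable_succ.
  apply: computable_pair computable_id.
  apply: computable_pair (computable_const _) _.
  apply: computable_add (computable_const _); apply: computable_mulc.
  apply: computable_pair (computable_const _) _; apply: computable_succ.
  apply: computable_pair (computable_const _).
  exact: computable_mulc computable_id.
(* The program takes [p] as its one argument, saves the [k] actual parameters, starts at address 2
   and delivers the answer to address 1. *)
have [b hb] := recfun_compilable (RComp f [:: fc]) 1 k 2 1.
case: D0 D1 eD0 eD1 (wf_of D0) (wf_of D1) => [[S0 m0] aD0] [[S1 m1] aD1] /=.
move=> eD0 eD1 wf0 wf1 {wf_of}.
(* Layout: [main p], the dispatcher, the program [b], then copies of the systems of [D0] and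
   [D1]. *)
pose off0 := 2 + size b; pose off1 := off0 + size S0; pose sz := off1 + size S1.
pose r0 m := if m < size S0 then off0 + m else sz.
pose r1 m := if m < size S1 then off1 + m else sz.
pose disp := branch k.+1 (Var 0) (Num 0) (r0 m0) (vars 1 k) (r1 m1) (vars 1 k).
pose rest := disp :: b ++ map (rename_calls r0) S0 ++ map (rename_calls r1) S1.
(* No circularity arises: [rest] does not mention [p]. *)
pose p := seq_code (map equation_code rest); pose S := main p :: rest.
have h0 : onth S 0 = Some (main p) by [].
have h1 : onth S 1 = Some disp by [].
have hr0 m : onth S (r0 m) = omap (rename_calls r0) (onth S0 m).
  apply: (@onth_relocated [:: main p, disp & b] S0 (map (rename_calls r1) S1)).
  move=> i; rewrite /r0 /= !size_cat !size_map /sz /off1 /off0.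
  by case: ifP => _; lia.
have eS : S = ([:: main p, disp & b] ++ map (rename_calls r0) S0) ++
              map (rename_calls r1) S1 ++ [::] by rewrite cats0 -catA.
have hr1 m : onth S (r1 m) = omap (rename_calls r1) (onth S1 m).
  rewrite eS; apply: onth_relocated.
  move=> i; rewrite /r1 /= !size_cat !size_map /sz /off1 /off0 /=.
  by case: ifP => _; lia.
have pb : placed b 2 S.
  by move=> i e hi; rewrite /= onth_cat (onth_lt hi).
have ar1 : sys_arity S 1 = Some k.+1 by rewrite (onth_arity h1) size_iota.
have [wb ab ib] := hb S pb ar1.
have wfS : sys_wf S.
  apply/and3P; split.
  - by apply: goto_wf; [rewrite ab /= size_vars | rewrite /= vars_closed].
  - apply: branch_wf => //; try exact: vars_closed.
      by rewrite /sys_arity hr0 eD0 /= sz0 size_vars.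
    by rewrite /sys_arity hr1 eD1 /= sz1 size_vars.
  - change (all (eq_wf S)
      (b ++ map (rename_calls r0) S0 ++ map (rename_calls r1) S1)).
    by rewrite !all_cat wb !relocated_wf.
have aE : arity (S, 0) == Some k.
  by rewrite /arity wfS (onth_arity h0) size_iota.
have codeE : ident_code (S, 0) = code p by [].
have run n ns : size ns = k -> reval f [:: code p] n ->
    sbisim (call S 0 ns) (call S 1 (n :: ns)).
  move=> hns rn.
  apply: sbisim_trans (ib [:: p] n ns erefl hns (reval_comp1 (hfc p) rn)).
  apply: (call_goto h0) => //=; congr cons.
  by apply: (eval_vars (u := [::]) (w := [::])); rewrite ?cats0.
exists (PDef aE); split=> [|n] /=; rewrite codeE => rn;
  apply: sbisim_pdef_eq => ns hns /=; apply: (sbisim_trans (run _ _ hns rn)).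
- apply: (@sbisim_trans (call S (r0 m0) ns)); last exact: sbisim_relocate.
  apply: (call_branch h1) => //=; first by rewrite hns.
  by apply: (eval_vars (u := [:: 0]) (w := [::])); rewrite ?cats0.
- apply: (@sbisim_trans (call S (r1 m1) ns)); last exact: sbisim_relocate.
  apply: (call_branchN h1) => //=; first by rewrite hns.
  by apply: (eval_vars (u := [:: n.+1]) (w := [::])); rewrite ?cats0.
Qed.

Theorem theorem5p2 (k : nat) (U : nat -> seq nat -> pdef k.+1)
    (B : pdef k -> Prop) :
  universal U ->
  (exists D : pdef k, B D) ->
  (exists D : pdef k, ~ B D) ->
  (forall D D' : pdef k, B D -> pdef_eq D' D -> B D') ->
  ~ decidable_set
      (fun j : nat => exists (i : nat) (J : seq nat),
         is_index k i J j /\ B (instance (U i J) j)).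
Proof.
move=> univ [D0 BD0] [D1 nBD1] closed [f hf].
have [E [E0 E1]] := self_referential_pdef f D0 D1.
have [f1 f0] := hf (ident_code E).
(* If the code of [E] were in the set, the answer 1 would make [E] equal to [D1], while universality
   and injectivity of the codes would put [E] in [B]. *)
have nX : ~ exists i J, is_index k i J (ident_code E) /\
    B (instance (U i J) (ident_code E)).
  move=> X; have eqE1 := E1 0 (f1 X).
  case: X => i [J [[D [tD /pdef_code_inj eD]] BU]]; subst D; apply: nBD1.
  have BE : B E := closed _ _ BU (pdef_eq_sym (univ _ _ _ tD)).
  exact: closed BE (pdef_eq_sym eqE1).
(* So the answer is 0 and [E] equals [D0]; any type of [E] then puts its code in the set. *)
have BE : B E := closed _ _ BD0 (E0 (f0 nX)).
have [i [J tE]] := pdef_has_type E.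
by apply: nX; exists i, J; split; [exists E | apply: closed BE (univ _ _ _ tE)].
Qed.
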